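(* Let $q$ be a prime with $q \equiv 3 \pmod 4$, and let $C_1 > \sqrt[4]{2}$. Suppose $E \subset \mathbb{F}_q^2$ satisfies $|E| > C_1 q^{7/4}$. Then there exists $C_2 > 0$ depending only on $C_1$ such that $|T_2(E)| \ge C_2 q^3$, where $T_2(E)$ is the set of congruence classes of triangles determined by $E$.
   Context: For $x=(x_1,x_2), y=(y_1,y_2) \in \mathbb{F}_q^2$ the ''distance'' is $\|x-y\| = (x_1-y_1)^2+(x_2-y_2)^2 \in \mathbb{F}_q$. A triangle determined by $E$ is a triple $(x^1,x^2,x^3)$ of points of $E$. Two triples $(x^1,x^2,x^3)$ and $(y^1,y^2,y^3)$ of points of $\mathbb{F}_q^2$ are congruent if there exist $\theta \in O_2(\mathbb{F}_q)$ (the group of $2\times 2$ matrices $A$ over $\mathbb{F}_q$ with $A^TA=I$) and $\tau \in \mathbb{F}_q^2$ such that $y^j = \theta x^j + \tau$ for $j=1,2,3$. $T_2(E)$ is the set of congruence classes (among all triples in $\mathbb{F}_q^2$) containing at least one triangle with vertices in $E$. *)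

(* Defs.v *)
From HB Require Import structures.
From mathcomp Require Import all_boot all_order all_algebra.
From Stdlib Require Import Reals.

Set Implicit Arguments.
Unset Strict Implicit.
Unset Printing Implicit Defensive.

Import GRing.Theory.
Local Open Scope ring_scope.

Definition pt (q : nat) := 'cV['F_q]_2.

Definition tri (q : nat) := (pt q * pt q * pt q)%type.

Definition orthogonal2 (q : nat) (A : 'M['F_q]_2) : bool := A^T *m A == 1%:M.

Definition congruentb (q : nat) (x y : tri q) : bool :=
  [exists A : 'M['F_q]_2, [exists tau : pt q,
     [&& orthogonal2 A,
         y.1.1 == A *m x.1.1 + tau,
         y.1.2 == A *m x.1.2 + tau &
         y.2 == A *m x.2 + tau]]].

Definition cong_class (q : nat) (x : tri q) : {set tri q} :=
  [set y | congruentb x y].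

Definition triangles (q : nat) (E : {set pt q}) : {set tri q} :=
  [set t : tri q | [&& t.1.1 \in E, t.1.2 \in E & t.2 \in E]].

Definition T2 (q : nat) (E : {set pt q}) : {set {set tri q}} :=
  [set cong_class t | t in triangles E].

(* Main.v *)
Require Import Defs.
From HB Require Import structures.
From mathcomp Require Import all_boot all_order all_algebra all_field.
From mathcomp Require Import ring lra zify.

(** For a rigid motion g let r(g) be the number of x in E with g x in E, and let
    n = |E|.  By Cauchy-Schwarz, n^6 is at most |T2 E| times the number of pairs
    of congruent triangles of E, and the latter is at most the sum of r(g)^3.
    The mean of r over translations is mu = n^2/q^2, and r^3 <= 2 mu^2 r +
    2 n (r - mu)^2, so only the variance of r is needed.  With f the indicator
    of E minus its mean and C its autocorrelation, the variance is governed by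
    the sum over t of a_t^2, where a_t is the sum of C over the circle of radius
    t, because exactly two isometries carry a nonzero vector to a given vector
    of the same norm.  Cauchy-Schwarz bounds a_t^2 by |f|^2 |A_t f|^2, A_t being
    the circle average, and the sum over t of |A_t f|^2 is the sum over w of
    C(w) #{d : |d + w| = |d|}.  For w <> 0 that set is a line, and C sums to 0,
    so the total is at most q^2 |f|^2.  This gives 16 |T2 E| >= q^3 as soon as
    n^3 >= q^5. *)

(** * Isometries, bisectors and circles in an anisotropic plane over a finite field *)

Section AnisotropicPlane.
Set Implicit Arguments.
Unset Strict Implicit.
Import Order.TTheory GRing.Theory Num.Theory.
Local Open Scope ring_scope.

Variable F : finFieldType.
Implicit Types (d w x y : 'cV[F]_2) (A : 'M[F]_2) (a b : F).

Definition sqnorm d : F := d 0 0 ^+ 2 + d 1 0 ^+ 2.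

Definition col2 a b : 'cV[F]_2 := \col_i (if i == 0 then a else b).

Definition isometry2 A : bool := A^T *m A == 1%:M.

Lemma ord2_cases (i : 'I_2) : i = 0 \/ i = 1.
Proof. by case: i => [[|[|//]] i]; [left|right]; apply/val_inj. Qed.

Lemma sum_ord2 (V : nmodType) (f : 'I_2 -> V) : \sum_i f i = f 0 + f 1.
Proof.
by rewrite big_ord_recl big_ord1; congr (_ + f _); apply/val_inj.
Qed.

Lemma col2_eq x y : x 0 0 = y 0 0 -> x 1 0 = y 1 0 -> x = y.
Proof. by move=> e0 e1; apply/colP => i; case: (ord2_cases i) => ->. Qed.

Lemma mulmx2E A x i : (A *m x) i 0 = A i 0 * x 0 0 + A i 1 * x 1 0.
Proof. by rewrite mxE sum_ord2. Qed.

Lemma isometry2P A :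
  reflect [/\ A 0 0 ^+ 2 + A 1 0 ^+ 2 = 1, A 0 1 ^+ 2 + A 1 1 ^+ 2 = 1
            & A 0 0 * A 0 1 + A 1 0 * A 1 1 = 0] (isometry2 A).
Proof.
apply: (iffP eqP) => [e|[e0 e1 e2]].
  have h i j : A 0 i * A 0 j + A 1 i * A 1 j = (i == j)%:R.
    by move/matrixP/(_ i j): e; rewrite !mxE sum_ord2 !mxE.
  by split; rewrite ?expr2 h.
apply/matrixP => i j; rewrite !mxE sum_ord2 !mxE.
case: (ord2_cases i) => ->; case: (ord2_cases j) => -> /=; rewrite -?expr2 //.
by rewrite mulrC (mulrC (A 1 1)).
Qed.

Lemma isometry2_sqnorm A d : isometry2 A -> sqnorm (A *m d) = sqnorm d.
Proof.
case/isometry2P=> e0 e1 e2; rewrite /sqnorm !mulmx2E.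
transitivity ((A 0 0 ^+ 2 + A 1 0 ^+ 2) * d 0 0 ^+ 2
  + (A 0 1 ^+ 2 + A 1 1 ^+ 2) * d 1 0 ^+ 2
  + 2 * (A 0 0 * A 0 1 + A 1 0 * A 1 1) * d 0 0 * d 1 0); first by ring.
by rewrite e0 e1 e2; ring.
Qed.

Lemma isometry2_mulmx_inj A : isometry2 A -> injective (mulmx A : 'cV_2 -> 'cV_2).
Proof.
by move=> /eqP e x y /(congr1 (mulmx A^T)); rewrite !mulmxA e !mul1mx.
Qed.

Definition rotation a b : 'M[F]_2 :=
  \matrix_(i, j) (if i == j then a else if i == 0 then - b else b).

Definition reflection a b : 'M[F]_2 :=
  \matrix_(i, j) (if i == j then if i == 0 then a else - a else b).

(** The second column is orthogonal to the unit first column [(a, c)], hence equals [D] times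
    [(-c, a)] with [D] the determinant; Lagrange's identity forces [D ^+ 2 = 1]. *)
Lemma isometry2_rot_or_refl A : isometry2 A ->
  A = rotation (A 0 0) (A 1 0) \/ A = reflection (A 0 0) (A 1 0).
Proof.
case/isometry2P; set a := A 0 0; set b := A 0 1; set c := A 1 0; set d := A 1 1.
move=> e0 e1 e2; set D := a * d - b * c.
have hd : d = a * D.
  transitivity (d * (a ^+ 2 + c ^+ 2)); first by rewrite e0 mulr1.
  transitivity (a * D + c * (a * b + c * d)); first by rewrite /D; ring.
  by rewrite e2; ring.
have hb : b = - c * D.
  transitivity (b * (a ^+ 2 + c ^+ 2)); first by rewrite e0 mulr1.
  transitivity (- c * D + a * (a * b + c * d)); first by rewrite /D; ring.
  by rewrite e2; ring.
have : D ^+ 2 == 1.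
  apply/eqP; transitivity ((a ^+ 2 + c ^+ 2) * (b ^+ 2 + d ^+ 2) - (a * b + c * d) ^+ 2).
    by rewrite /D; ring.
  by rewrite e0 e1 e2; ring.
rewrite sqrf_eq1 => /orP[]/eqP hD; [left|right];
  apply/matrixP => i j; rewrite !mxE;
  case: (ord2_cases i) => ->; case: (ord2_cases j) => -> //=.
- by rewrite -/b hb hD mulr1.
- by rewrite -/d hd hD mulr1.
- by rewrite -/b hb hD mulrN1 opprK.
- by rewrite -/d hd hD mulrN1.
Qed.

Hypothesis two_neq0 : (2 : F) != 0.
Hypothesis sqnorm_eq0 : forall d, sqnorm d = 0 -> d = 0.

(** One rotation and one reflection: in each family the image of [d] determines the two parameters
    through a linear system of determinant [sqnorm d], nonzero by anisotropy. *)
Lemma card_isometry2_to d w : d != 0 -> sqnorm w = sqnorm d ->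
  #|[set A | isometry2 A && (A *m d == w)]| = 2%N.
Proof.
move=> d0 hw; set N := sqnorm d.
have N0 : N != 0 by apply: contra_neq d0; apply: sqnorm_eq0.
have hN : d 0 0 ^+ 2 + d 1 0 ^+ 2 = N by [].
have hW : w 0 0 ^+ 2 + w 1 0 ^+ 2 = N by [].
(* With vectors read as complex numbers, [a + ib] is [w / d], and [a' + ib'] is [w] divided by the
   conjugate of [d]. *)
pose a := (d 0 0 * w 0 0 + d 1 0 * w 1 0) / N.
pose b := (d 0 0 * w 1 0 - d 1 0 * w 0 0) / N.
pose a' := (d 0 0 * w 0 0 - d 1 0 * w 1 0) / N.
pose b' := (d 1 0 * w 0 0 + d 0 0 * w 1 0) / N.
have NN : N / N = 1 by rewrite divff.
have ab : a ^+ 2 + b ^+ 2 = 1.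
  transitivity (((d 0 0 ^+ 2 + d 1 0 ^+ 2) * (w 0 0 ^+ 2 + w 1 0 ^+ 2)) * N^-1 ^+ 2).
    by rewrite /a /b; ring.
  by rewrite hN hW -expr2 -exprMn NN expr1n.
have ab' : a' ^+ 2 + b' ^+ 2 = 1.
  transitivity (((d 0 0 ^+ 2 + d 1 0 ^+ 2) * (w 0 0 ^+ 2 + w 1 0 ^+ 2)) * N^-1 ^+ 2).
    by rewrite /a' /b'; ring.
  by rewrite hN hW -expr2 -exprMn NN expr1n.
have -> : [set A | isometry2 A && (A *m d == w)] = [set rotation a b; reflection a' b'].
  apply/setP => A; rewrite !inE; apply/andP/orP.
    case=> /isometry2_rot_or_refl; set s := A 0 0; set t := A 1 0.
    case=> hA /eqP hAw; [left|right]; apply/eqP; rewrite hA; congr (_ _ _);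
      rewrite /a /b /a' /b' -hAw hA !mulmx2E !mxE /=.
    - by transitivity (s * ((d 0 0 ^+ 2 + d 1 0 ^+ 2) / N)); [rewrite hN NN mulr1|ring].
    - by transitivity (t * ((d 0 0 ^+ 2 + d 1 0 ^+ 2) / N)); [rewrite hN NN mulr1|ring].
    - by transitivity (s * ((d 0 0 ^+ 2 + d 1 0 ^+ 2) / N)); [rewrite hN NN mulr1|ring].
    - by transitivity (t * ((d 0 0 ^+ 2 + d 1 0 ^+ 2) / N)); [rewrite hN NN mulr1|ring].
  case=> /eqP->; split.
  - by apply/isometry2P; rewrite !mxE /=; split=> //; rewrite -?ab; ring.
  - apply/eqP/col2_eq; rewrite mulmx2E !mxE /=.
      transitivity (w 0 0 * ((d 0 0 ^+ 2 + d 1 0 ^+ 2) / N)); first by rewrite /a /b; ring.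
      by rewrite hN NN mulr1.
    transitivity (w 1 0 * ((d 0 0 ^+ 2 + d 1 0 ^+ 2) / N)); first by rewrite /a /b; ring.
    by rewrite hN NN mulr1.
  - by apply/isometry2P; rewrite !mxE /=; split=> //; rewrite -?ab'; ring.
  - apply/eqP/col2_eq; rewrite mulmx2E !mxE /=.
      transitivity (w 0 0 * ((d 0 0 ^+ 2 + d 1 0 ^+ 2) / N)); first by rewrite /a' /b'; ring.
      by rewrite hN NN mulr1.
    transitivity (w 1 0 * ((d 0 0 ^+ 2 + d 1 0 ^+ 2) / N)); first by rewrite /a' /b'; ring.
    by rewrite hN NN mulr1.
rewrite cards2; case: eqP => //= e.
(* If the two matrices coincided, their entries would give [a = - a] and [b = - b], against
   [a ^+ 2 + b ^+ 2 = 1]. *)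
have h i j := congr1 (fun M : 'M_2 => M i j) e.
have := h 0 0; rewrite !mxE /= => ha.
have := h 1 1; rewrite !mxE /= => ha'.
have := h 1 0; rewrite !mxE /= => hb.
have := h 0 1; rewrite !mxE /= => hb'.
have z (u : F) : u = - u -> u = 0.
  move=> hu; apply/eqP; have /eqP : 2 * u = 0 by rewrite mulr_natl mulr2n {1}hu addNr.
  by rewrite mulf_eq0 (negPf two_neq0).
have a0 : a = 0 by apply: z; rewrite {2}ha.
have b0 : b = 0 by apply: z; rewrite hb' hb.
by move/eqP: ab; rewrite a0 b0 expr0n addr0 eq_sym oner_eq0.
Qed.

Lemma card_bisector w : w != 0 -> #|[set d | sqnorm (d + w) == sqnorm d]| = #|F|.
Proof.
move=> w0; set N := sqnorm w.
have N0 : N != 0 by apply: contra_neq w0; apply: sqnorm_eq0.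
(* The bisector of [0] and [- w], run from its midpoint along the normal of [w]. *)
pose p (s : F) := col2 (- w 0 0 / 2 - s * w 1 0) (- w 1 0 / 2 + s * w 0 0).
have p_inj : injective p.
  move=> s t e.
  have e0 := congr1 (fun M : 'cV_2 => M 0 0) e.
  have e1 := congr1 (fun M : 'cV_2 => M 1 0) e.
  move: e0 e1; rewrite !mxE /= => e0 e1.
  have st0 : (s - t) * w 0 0 = 0.
    by move/eqP: e1; rewrite (inj_eq (addrI _)) -subr_eq0 -mulrBl => /eqP.
  have st1 : (s - t) * w 1 0 = 0.
    by move/eqP: e0; rewrite (inj_eq (addrI _)) eqr_opp -subr_eq0 -mulrBl => /eqP.
  apply/eqP; rewrite -subr_eq0 -(mulIr_eq0 _ (mulIf N0)); apply/eqP.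
  transitivity ((s - t) * w 0 0 * w 0 0 + (s - t) * w 1 0 * w 1 0).
    by rewrite /N /sqnorm; ring.
  by rewrite st0 st1 !mul0r addr0.
rewrite -(card_imset _ p_inj); apply: eq_card => d; rewrite !inE.
apply/eqP/imsetP.
  (* [(x, y)] is [d] measured from the midpoint [- w / 2]. It is orthogonal to [w], so its component
     along the normal is the parameter sought. *)
  move=> e; set x := d 0 0 + w 0 0 / 2; set y := d 1 0 + w 1 0 / 2.
  have hN : w 0 0 ^+ 2 + w 1 0 ^+ 2 = N by [].
  have xy : x * w 0 0 + y * w 1 0 = 0.
    apply: (mulfI two_neq0); rewrite mulr0.
    transitivity (sqnorm (d + w) - sqnorm d); last by rewrite e subrr.
    by rewrite /x /y /sqnorm !mxE; field.
  exists ((y * w 0 0 - x * w 1 0) / N) => //; apply/col2_eq; rewrite !mxE /=.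
    transitivity (x - w 0 0 / 2); first by rewrite /x addrK.
    transitivity (x * (w 0 0 ^+ 2 + w 1 0 ^+ 2) / N - w 0 0 / 2 - (x * w 0 0 + y * w 1 0) * w 0 0 / N).
      by rewrite hN mulfK // xy !mul0r subr0.
    by ring.
  transitivity (y - w 1 0 / 2); first by rewrite /y addrK.
  transitivity (y * (w 0 0 ^+ 2 + w 1 0 ^+ 2) / N - w 1 0 / 2 - (x * w 0 0 + y * w 1 0) * w 1 0 / N).
    by rewrite hN mulfK // xy !mul0r subr0.
  by ring.
by case=> s _ ->; rewrite /sqnorm !mxE /=; field.
Qed.

(** Each first coordinate leaves at most two second coordinates, opposite square roots of one
    element. *)
Lemma card_circle_le t : (#|[set d | sqnorm d == t]| <= 2 * #|F|)%N.
Proof.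
(* A chosen square root of [t - a ^+ 2]; the default 0 fills in for those [a] that no point of the
   circle has as first coordinate. *)
pose c (a : F) := odflt 0 [pick b | a ^+ 2 + b ^+ 2 == t].
pose g (u : bool * F) := col2 u.2 (if u.1 then c u.2 else - c u.2).
have -> : (2 * #|F| = #|{: bool * F}|)%N by rewrite card_prod card_bool.
rewrite -cardsT; apply: leq_trans (leq_imset_card g _); apply/subset_leq_card/subsetP => d.
rewrite inE => /eqP hd; apply/imsetP.
have : d 1 0 ^+ 2 == c (d 0 0) ^+ 2.
  rewrite /c; case: pickP => [b /eqP hb|/(_ (d 1 0))] /=.
    by rewrite -(inj_eq (addrI (d 0 0 ^+ 2))) hb -hd.
  by rewrite -/(sqnorm d) hd eqxx.
rewrite eqf_sqr => /orP[] /eqP e; [exists (true, d 0 0)|exists (false, d 0 0)] => //;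
  by apply: col2_eq; rewrite !mxE.
Qed.

(** Isometries are sorted by the image of [(1, 0)], one of at most [2 * #|F|] points of the unit
    circle; each image comes from two isometries. *)
Lemma card_isometry2_le : (#|[set A | isometry2 A]| <= 4 * #|F|)%N.
Proof.
pose e := col2 1 0.
have ne : sqnorm e = 1 by rewrite /sqnorm !mxE /= expr1n expr0n addr0.
have e0 : e != 0.
  by apply/eqP=> h; move/eqP: ne; rewrite h /sqnorm !mxE expr0n addr0 eq_sym oner_eq0.
rewrite -sum1_card (partition_big (fun A => A *m e) (mem [set d | sqnorm d == 1])) /=; last first.
  by move=> A; rewrite !inE => /isometry2_sqnorm->; rewrite ne.
rewrite (eq_bigr (fun=> 2%N)) => [|w]; last first.
  rewrite inE => /eqP hw; apply: etrans (card_isometry2_to e0 _); last by rewrite ne; exact: hw.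
  rewrite -sum1_card.
  by apply: eq_bigl => A; rewrite !inE.
by rewrite sum_nat_const (leq_trans (leq_mul (card_circle_le 1) (leqnn 2))) // mulnC mulnA.
Qed.


(** * Autocorrelation, circle sums and the energy over all isometries *)

Section Energy.
Variables (K : realFieldType) (f : 'cV[F]_2 -> K).
Hypothesis sum_f : \sum_x f x = 0.

Definition autocorr d : K := \sum_y f y * f (y + d).

Lemma autocorr_shift d w : \sum_y f (y + d) * f (y + w) = autocorr (w - d).
Proof.
rewrite /autocorr (reindex_inj (addIr (- d))) /=; apply: eq_bigr => y _.
by rewrite subrK addrAC addrA.
Qed.

Lemma autocorr0 : autocorr 0 = \sum_x f x ^+ 2.
Proof. by apply: eq_bigr => y _; rewrite addr0. Qed.

Lemma sum_autocorr : \sum_d autocorr d = 0.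
Proof.
rewrite exchange_big big1 // => y _; rewrite -mulr_sumr.
by rewrite -(reindex_inj (addrI y) (F := f) (P := xpredT)) sum_f mulr0.
Qed.

Lemma sum_circle_average_sqr :
  \sum_(t : F) \sum_y (\sum_(d | sqnorm d == t) f (y + d)) ^+ 2
    <= #|F|%:R ^+ 2 * \sum_x f x ^+ 2.
Proof.
have -> : \sum_(t : F) \sum_y (\sum_(d | sqnorm d == t) f (y + d)) ^+ 2 =
    \sum_w autocorr w *+ #|[set d | sqnorm (d + w) == sqnorm d]|.
  transitivity (\sum_d \sum_(w | sqnorm w == sqnorm d) autocorr (w - d)).
    rewrite exchange_big /=.
    transitivity (\sum_y \sum_d \sum_(w | sqnorm w == sqnorm d) f (y + d) * f (y + w)).
      apply: eq_bigr => y _; rewrite (partition_big (fun d => sqnorm d) xpredT (P := xpredT)) //=.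
      apply: eq_bigr => t _; rewrite expr2 big_distrlr /=.
      by apply: eq_bigr => d /eqP ->.
    rewrite exchange_big; apply: eq_bigr => d _; rewrite exchange_big.
    by apply: eq_bigr => w _; rewrite autocorr_shift.
  transitivity (\sum_d \sum_(w | sqnorm (d + w) == sqnorm d) autocorr w).
    apply: eq_bigr => d _; rewrite (reindex_inj (addrI d)).
    by apply: eq_bigr => w _; rewrite addrAC subrr add0r.
  rewrite (exchange_big_dep xpredT) //=; apply: eq_bigr => w _.
  by rewrite -sumr_const; apply: eq_bigl => d; rewrite inE.
(* The term [w = 0] has weight [#|F| ^ 2]. The others share the weight [#|F|] and, as [autocorr]
   sums to 0, contribute a nonpositive total. *)
rewrite (bigD1 0) //= autocorr0.
under eq_bigr => w w0 do rewrite card_bisector //.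
rewrite sumrMnl.
have := sum_autocorr; rewrite (bigD1 0) //= autocorr0 => /eqP.
rewrite addrC addr_eq0 => /eqP->.
have -> : #|[set d | sqnorm (d + 0) == sqnorm d]| = (#|F| ^ 2)%N.
  by rewrite -(card_mx F 2 1) -cardsT; apply: eq_card => d; rewrite !inE addr0 eqxx.
rewrite -[X in X + _]mulr_natl natrX gerDl mulNrn oppr_le0 mulrn_wge0 // sumr_ge0 // => x _.
exact: sqr_ge0.
Qed.

(** By Lagrange's identity the double sum of [(a i * b j - a j * b i) ^+ 2] is twice the difference
    of the two sides. *)
Lemma cauchy_schwarz (I : finType) (P : pred I) (a b : I -> K) :
  (\sum_(i | P i) a i * b i) ^+ 2 <=
    (\sum_(i | P i) a i ^+ 2) * (\sum_(i | P i) b i ^+ 2).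
Proof.
set A := \sum_(i | P i) a i ^+ 2; set B := \sum_(i | P i) b i ^+ 2.
set C := \sum_(i | P i) a i * b i.
have : 0 <= \sum_(i | P i) \sum_(j | P j) (a i * b j - a j * b i) ^+ 2.
  by apply: sumr_ge0 => i _; apply: sumr_ge0 => j _; apply: sqr_ge0.
have -> : \sum_(i | P i) \sum_(j | P j) (a i * b j - a j * b i) ^+ 2
    = A * B + B * A - 2 * (C * C).
  rewrite /A /B /C !big_distrlr /= mulr_sumr -big_split -sumrB /=.
  apply: eq_bigr => i _; rewrite mulr_sumr -big_split -sumrB /=.
  by apply: eq_bigr => j _; ring.
by rewrite expr2; lra.
Qed.

Lemma sum_circle_autocorr_sqr :
  \sum_(t : F) (\sum_(d | sqnorm d == t) autocorr d) ^+ 2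
    <= #|F|%:R ^+ 2 * (\sum_x f x ^+ 2) ^+ 2.
Proof.
set S := \sum_x f x ^+ 2.
have S0 : 0 <= S by apply: sumr_ge0 => x _; apply: sqr_ge0.
apply: le_trans (_ : S * \sum_(t : F) \sum_y (\sum_(d | sqnorm d == t) f (y + d)) ^+ 2 <= _).
  rewrite mulr_sumr; apply: ler_sum => t _.
  rewrite exchange_big /=; under eq_bigr => y _ do rewrite -mulr_sumr.
  exact: cauchy_schwarz.
by rewrite (expr2 S) mulrA mulrC ler_wpM2r // sum_circle_average_sqr.
Qed.

Lemma isometry2_energy :
  \sum_(A | isometry2 A) \sum_w (\sum_x f x * f (A *m x + w)) ^+ 2
    <= (4 * #|F|%:R + 2 * #|F|%:R ^+ 2) * (\sum_x f x ^+ 2) ^+ 2.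
Proof.
set S := \sum_x f x ^+ 2.
have -> : \sum_(A | isometry2 A) \sum_w (\sum_x f x * f (A *m x + w)) ^+ 2 =
   \sum_(A | isometry2 A) \sum_d autocorr d * autocorr (A *m d).
  apply: eq_bigr => A hA.
  (* Once the square is expanded, summing over [w] leaves an autocorrelation that depends only on
     [y - x], the future [d]. *)
  transitivity (\sum_x \sum_y f x * f y * autocorr (A *m (y - x))).
    under eq_bigr => w _ do rewrite expr2 big_distrlr /=.
    rewrite exchange_big; apply: eq_bigr => x _.
    rewrite exchange_big; apply: eq_bigr => y _ /=.
    rewrite mulmxBr -autocorr_shift mulr_sumr; apply: eq_bigr => w _.
    by rewrite (addrC w) (addrC w); ring.
  under eq_bigr => x _.
    rewrite (reindex_inj (addrI x)).
    under eq_bigr => d _ do rewrite addrAC subrr add0r.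
    over.
  by rewrite exchange_big; apply: eq_bigr => d _; rewrite mulr_suml.
(* The vector 0 is fixed by every isometry, so it is split off before the count of two isometries
   per target is applied. *)
rewrite exchange_big (bigD1 0) //=.
have -> : \sum_(A : 'M[F]_2 | isometry2 A) autocorr 0 * autocorr (A *m 0)
    = #|[set A : 'M[F]_2 | isometry2 A]|%:R * S ^+ 2.
  rewrite mulr_natl -sumr_const; apply: eq_big => A; first by rewrite inE.
  by rewrite mulmx0 autocorr0.
have -> : \sum_(d | d != 0) \sum_(A | isometry2 A) autocorr d * autocorr (A *m d)
    = 2 * \sum_(d | d != 0) \sum_(w | sqnorm w == sqnorm d) autocorr d * autocorr w.
  rewrite mulr_sumr; apply: eq_bigr => d d0.
  rewrite (partition_big (fun A => A *m d) (fun w => sqnorm w == sqnorm d)) /=; last first.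
    by move=> A /isometry2_sqnorm ->.
  rewrite mulr_sumr; apply: eq_bigr => w /eqP hw.
  rewrite mulr_natl -[in RHS](card_isometry2_to d0 hw) -sumr_const; apply: eq_big => A.
    by rewrite inE.
  by case/andP=> _ /eqP ->.
have h1 := sum_circle_autocorr_sqr.
(* Restoring [d = 0] adds only the square of [autocorr 0], since by anisotropy 0 is alone on its
   circle. *)
have h2 : \sum_(d | d != 0) \sum_(w | sqnorm w == sqnorm d) autocorr d * autocorr w
   <= \sum_(t : F) (\sum_(d | sqnorm d == t) autocorr d) ^+ 2.
  have -> : \sum_(t : F) (\sum_(d | sqnorm d == t) autocorr d) ^+ 2 =
    \sum_d \sum_(w | sqnorm w == sqnorm d) autocorr d * autocorr w.
    rewrite (partition_big (fun d => sqnorm d) xpredT (P := xpredT)) //=.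
    apply: eq_bigr => t _; rewrite expr2 big_distrlr /=.
    by apply: eq_bigr => d /eqP ->.
  rewrite [leRHS](bigD1 0) //= lerDr (big_pred1 0) => [|w].
    by rewrite -expr2 sqr_ge0.
  by rewrite /= {2}/sqnorm !mxE expr0n addr0; apply/eqP/eqP => [/sqnorm_eq0 //|->];
    rewrite /sqnorm !mxE expr0n addr0.
rewrite [leRHS]mulrDl; apply: lerD.
  by apply: ler_wpM2r; [exact: sqr_ge0|rewrite -natrM ler_nat card_isometry2_le].
by rewrite -mulrA ler_pM2l ?ltr0n // (le_trans h2).
Qed.

End Energy.

(** * Overlaps of a set with its images under rigid motions *)

Section Overlap.
Variable E : {set 'cV[F]_2}.

(** This is r(g) for the rigid motion g sending [x] to [A *m x + w]. *)
Definition overlap A w : nat := #|[set x in E | A *m x + w \in E]|.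

Lemma overlapE A w :
  (overlap A w)%:R = \sum_x (x \in E)%:R * (A *m x + w \in E)%:R :> rat.
Proof.
rewrite /overlap -sum1_card natr_sum big_mkcond /=; apply: eq_bigr => x _.
by rewrite inE; case: (x \in E); case: (_ \in E); rewrite /= ?mulr0 ?mul0r ?mulr1.
Qed.

Lemma sum_indicator : \sum_x (x \in E)%:R = #|E|%:R :> rat.
Proof. by rewrite -sum1_card natr_sum [RHS]big_mkcond; apply: eq_bigr => x _; case: ifP. Qed.

Lemma sum_overlap A : \sum_w (overlap A w)%:R = #|E|%:R ^+ 2 :> rat.
Proof.
under eq_bigr => w _ do rewrite overlapE.
rewrite exchange_big /= expr2 -{1}sum_indicator mulr_suml; apply: eq_bigr => x _.
rewrite -mulr_sumr; congr (_ * _).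
by rewrite -sum_indicator [RHS](reindex_inj (addrI (A *m x))).
Qed.

Definition balanced x : rat := (x \in E)%:R - #|E|%:R / #|F|%:R ^+ 2.

Lemma card_field_gt0 : 0 < #|F|%:R :> rat.
Proof. by rewrite ltr0n (cardD1 0). Qed.

Lemma sumr_const_plane (c : rat) : \sum_(x : 'cV[F]_2) c = #|F|%:R ^+ 2 * c.
Proof. by rewrite sumr_const card_mx muln1 -[LHS]mulr_natl natrX. Qed.

Lemma sum_balanced : \sum_x balanced x = 0.
Proof.
rewrite sumrB sum_indicator sumr_const_plane mulrC divfK ?subrr //.
by rewrite expf_neq0 // gt_eqF // card_field_gt0.
Qed.

(** An indicator equals its own square, so the sum is exactly n - n^2/q^2. *)
Lemma sum_balanced_sqr : \sum_x balanced x ^+ 2 <= #|E|%:R.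
Proof.
set m : rat := #|E|%:R / #|F|%:R ^+ 2.
have -> : \sum_x balanced x ^+ 2 = \sum_x (x \in E)%:R - m * \sum_x (x \in E)%:R - m * \sum_x balanced x.
  rewrite !mulr_sumr -!sumrB; apply: eq_bigr => x _; rewrite /balanced -/m.
  by case: (x \in E); rewrite /=; ring.
rewrite sum_balanced mulr0 subr0 sum_indicator gerDl oppr_le0.
by rewrite mulr_ge0 // divr_ge0 // exprn_ge0.
Qed.

(** This identifies the correlations bounded by [isometry2_energy] with the deviations of r(g) from
    its mean. *)
Lemma sum_balanced_correlation A w : isometry2 A ->
  \sum_x balanced x * balanced (A *m x + w)
    = (overlap A w)%:R - #|E|%:R ^+ 2 / #|F|%:R ^+ 2.
Proof.
move=> hA; set m : rat := #|E|%:R / #|F|%:R ^+ 2.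
have -> : \sum_x balanced x * balanced (A *m x + w) =
   \sum_x (x \in E)%:R * (A *m x + w \in E)%:R - m * \sum_x (x \in E)%:R
   - m * \sum_x balanced (A *m x + w).
  rewrite !mulr_sumr -!sumrB; apply: eq_bigr => x _.
  by rewrite /balanced -/m; ring.
rewrite -overlapE sum_indicator.
have inj : injective (fun x => A *m x + w).
  by move=> x y /addIr /(isometry2_mulmx_inj hA).
rewrite -(reindex_inj inj (P := xpredT) (F := balanced)) sum_balanced mulr0 subr0.
by rewrite /m expr2 mulrAC.
Qed.

Lemma sum_overlap_cube : (1 < #|F|)%N -> (#|F| ^ 5 <= #|E| ^ 3)%N ->
  ((\sum_(A | isometry2 A) \sum_w overlap A w ^ 3) * #|F| ^ 3 <= 16 * #|E| ^ 6)%N.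
Proof.
move=> F1 hE; rewrite -(ler_nat rat) natrM [leRHS]natrM natr_sum.
have q0 := card_field_gt0.
have q2 : 2 <= #|F|%:R :> rat by rewrite ler_nat.
have {hE} hE : #|F|%:R ^+ 5 <= #|E|%:R ^+ 3 :> rat by rewrite -!natrX ler_nat.
have n0 : 0 <= #|E|%:R :> rat by [].
rewrite !natrX; set n : rat := #|E|%:R in hE n0 *; set q : rat := #|F|%:R in q0 q2 hE *.
set mu : rat := n ^+ 2 / q ^+ 2.
have cube A w : isometry2 A -> (overlap A w ^ 3)%:R <=
   2 * mu ^+ 2 * (overlap A w)%:R
   + 2 * n * (\sum_x balanced x * balanced (A *m x + w)) ^+ 2.
  move=> hA; rewrite sum_balanced_correlation // -/n -/q -/mu natrX.
  have : (overlap A w)%:R <= n.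
    by rewrite ler_nat; apply/subset_leq_card/subsetP => x; rewrite inE => /andP[].
  have : 0 <= (overlap A w)%:R :> rat by [].
  move: (overlap A w)%:R => r r0 rn.
  (* The factor [r ^+ 2] is split by [(r - 2 * mu) ^+ 2 >= 0]; then [r <= n] is used on the
     deviation term only. *)
  have h1 : r * r ^+ 2 <= r * (2 * mu ^+ 2 + 2 * (r - mu) ^+ 2).
    apply: ler_wpM2l => //; have := sqr_ge0 (r - 2 * mu); lra.
  have h2 : r * (r - mu) ^+ 2 <= n * (r - mu) ^+ 2.
    by apply: ler_wpM2r => //; apply: sqr_ge0.
  rewrite exprS; lra.
have le1 : \sum_(A | isometry2 A) (\sum_w overlap A w ^ 3)%:R <=
  2 * mu ^+ 2 * (4 * q * n ^+ 2) + 2 * n * ((4 * q + 2 * q ^+ 2) * n ^+ 2).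
  apply: le_trans (_ : \sum_(A | isometry2 A) \sum_w (2 * mu ^+ 2 * (overlap A w)%:R
   + 2 * n * (\sum_x balanced x * balanced (A *m x + w)) ^+ 2) <= _).
    by apply: ler_sum => A hA; rewrite natr_sum; apply: ler_sum => w _; apply: cube.
  under eq_bigr => A hA do rewrite big_split -!mulr_sumr sum_overlap -/n /=.
  rewrite big_split /= -(mulr_sumr _ _ _ (2 * mu ^+ 2)) -(mulr_sumr _ _ _ (2 * n)).
  apply: lerD; apply: ler_wpM2l.
  - by rewrite mulr_ge0 // sqr_ge0.
  - rewrite sumr_const -[leLHS]mulr_natl ler_wpM2r ?sqr_ge0 //.
    have := card_isometry2_le; rewrite -(ler_nat rat) natrM -/q; apply: le_trans.
    by rewrite ler_nat cardsE.
  - by rewrite mulr_ge0.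
  - apply: le_trans (isometry2_energy sum_balanced) _; rewrite -/q.
    apply: ler_wpM2l; first by rewrite addr_ge0 ?mulr_ge0 ?sqr_ge0 ?ltW.
    rewrite !expr2; apply: ler_pM; rewrite ?sum_balanced_sqr //;
      by apply: sumr_ge0 => x _; apply: sqr_ge0.
apply: le_trans (ler_wpM2r _ le1) _; first by rewrite exprn_ge0 // ltW.
(* With [q >= 2] and [q ^+ 5 <= n ^+ 3], the last two terms are each at most 4 n^6, whence 8 + 4 + 4
   = 16. *)
have -> : (2 * mu ^+ 2 * (4 * q * n ^+ 2) + 2 * n * ((4 * q + 2 * q ^+ 2) * n ^+ 2)) * q ^+ 3
  = 8 * (n ^+ 3 * n ^+ 3) + 8 * (q ^+ 4 * n ^+ 3) + 4 * (q ^+ 5 * n ^+ 3).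
  by rewrite /mu; field; rewrite gt_eqF.
have h3 : 2 * (q ^+ 4 * n ^+ 3) <= q ^+ 5 * n ^+ 3.
  rewrite mulrA; apply: ler_wpM2r; first by rewrite exprn_ge0.
  by rewrite [q ^+ 5]exprS; apply: ler_wpM2r => //; rewrite exprn_ge0 // ltW.
have h4 : q ^+ 5 * n ^+ 3 <= n ^+ 3 * n ^+ 3.
  by apply: ler_wpM2r => //; rewrite exprn_ge0.
rewrite -[6%N]/(3 + 3)%N exprD; lra.
Qed.

End Overlap.

End AnisotropicPlane.

(** * Congruence classes of triangles and rigid motions *)

Section Triangles.
Set Implicit Arguments.
Unset Strict Implicit.
Import Order.TTheory GRing.Theory Num.Theory.

(** Cauchy-Schwarz between the constant 1 and the fiber sizes over the image; the sum on the right
    is the sum of squared fiber sizes. *)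
Lemma card_sqr_le_fibers (I J : finType) (h : I -> J) (P : {set I}) :
  (#|P| ^ 2 <= #|h @: P| * \sum_(t in P) #|[set u in P | h u == h t]|)%N.
Proof.
pose m c := #|[set u in P | h u == c]|.
have e1 : (#|P| = \sum_(c in h @: P) 1 * m c)%N.
  rewrite -sum1_card (partition_big h (mem (h @: P))) => [|t tP]; last exact: imset_f.
  apply: eq_bigr => c _; rewrite mul1n /m -sum1_card.
  by apply: eq_bigl => t; rewrite inE.
have e2 : (\sum_(t in P) #|[set u in P | h u == h t]| = \sum_(c in h @: P) m c ^ 2)%N.
  rewrite (partition_big h (mem (h @: P))) => [|t tP]; last exact: imset_f.
  apply: eq_bigr => c _; rewrite -mulnn {1}/m -sum1_card big_distrl /=.
  by apply: eq_big => [t|t /andP[_ /eqP ->]]; rewrite ?inE ?mul1n.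
rewrite -(ler_nat rat) natrM natrX e2 natr_sum.
have -> : (#|P|%:R = \sum_(c in h @: P) 1 * (m c)%:R :> rat)%R.
  by rewrite e1 natr_sum; apply: eq_bigr => c _; rewrite natrM.
have -> : (#|h @: P|%:R = \sum_(c in h @: P) 1 ^+ 2 :> rat)%R.
  by rewrite -sum1_card natr_sum; apply: eq_bigr => c _; rewrite expr1n.
under [X in (_ <= _ * X)%R]eq_bigr do rewrite natrX.
exact: cauchy_schwarz.
Qed.

Variable q : nat.
Implicit Types (t u : tri q) (E : {set pt q}).

Definition rigid_motion (g : 'M['F_q]_2 * pt q) t : tri q :=
  (g.1 *m t.1.1 + g.2, g.1 *m t.1.2 + g.2, g.1 *m t.2 + g.2)%R.

Lemma congruentbP t u :
  reflect (exists2 g : 'M['F_q]_2 * pt q, isometry2 g.1 & u = rigid_motion g t) (congruentb t u).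
Proof.
apply: (iffP existsP) => [[A /existsP[w /and4P[hA /eqP e1 /eqP e2 /eqP e3]]]|[[A w] /= hA ->]].
  exists (A, w) => //; case: u e1 e2 e3 => [[u1 u2] u3] /= -> -> ->.
  by [].
by exists A; apply/existsP; exists w; rewrite /= !eqxx !andbT.
Qed.

Lemma congruentb_refl t : congruentb t t.
Proof.
apply/congruentbP; exists (1%:M, 0)%R; first by rewrite /isometry2 trmx1 mul1mx.
by case: t => [[a b] c]; rewrite /rigid_motion /= !mul1mx !addr0.
Qed.

Lemma card_triangles E : #|triangles E| = (#|E| ^ 3)%N.
Proof.
have -> : triangles E = setX (setX E E) E.
  by apply/setP => -[[a b] c]; rewrite !inE /= andbA.
by rewrite !cardsX expnS mulnn mulnC expnSr.
Qed.

(** Each congruent pair is [t] with its image under some g, possibly several. For fixed g, the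
    triangles of [E] sent into [E] are the triples from a set of size r(g). *)
Lemma sum_class_le E :
  (\sum_(t in triangles E) #|[set u in triangles E | cong_class u == cong_class t]|
    <= \sum_(A : 'M['F_q]_2 | isometry2 A) \sum_w overlap E A w ^ 3)%N.
Proof.
apply: leq_trans (_ : \sum_(t in triangles E) \sum_(g : 'M['F_q]_2 * pt q | isometry2 g.1)
    (rigid_motion g t \in triangles E) <= _)%N.
  apply: leq_sum => t _; rewrite -big_mkcondr sum1dep_card.
  apply: leq_trans (leq_imset_card (rigid_motion^~ t) _); apply/subset_leq_card/subsetP => u.
  rewrite inE => /andP[uE /eqP e].
  have : u \in cong_class t by rewrite -e inE congruentb_refl.
  rewrite inE => /congruentbP[g hg eu]; apply/imsetP; exists g => //.
  by rewrite inE hg -eu.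
rewrite exchange_big [leqRHS]pair_big_dep /= leq_eqVlt; apply/orP; left; apply/eqP.
apply: eq_big => [g|[A w] _ /=]; first by rewrite andbT.
rewrite -big_mkcondr sum1dep_card.
set X := [set x in E | (A *m x + w)%R \in E].
have -> : [set t | (t \in triangles E) && (rigid_motion (A, w) t \in triangles E)] = setX (setX X X) X.
  apply/setP => -[[a b] c]; rewrite !inE /=.
  by case: (a \in E); case: (b \in E); case: (c \in E); rewrite /= ?andbF ?andbA.
by rewrite !cardsX /overlap expnS mulnn mulnC expnSr.
Qed.

(** * The plane over the prime field with q = 3 mod 4 *)

Hypotheses (q_prime : prime q) (q_mod4 : q %% 4 = 3).

Lemma two_neq0_Fp : (2 : 'F_q)%R != 0%R.
Proof.
rewrite -(dvdn_pcharf (pchar_Fp q_prime)).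
by apply/negP => /(dvdn_leq (isT : 0 < 2)%N) hq; move: q_mod4 hq; case: (q) q_prime => [|[|[|]]].
Qed.

(** A nonzero isotropic vector would make -1 a square. *)
Lemma sqnorm_eq0_Fp (d : 'cV['F_q]_2) : sqnorm d = 0%R -> d = 0%R.
Proof.
have sq a b : (a ^+ 2 + b ^+ 2 = 0 -> a = 0 :> 'F_q)%R.
  move=> h; apply/eqP/negPn/negP => a0.
  have ba : ((b / a) ^+ 2 = -1)%R.
    move/eqP: h; rewrite addrC addr_eq0 => /eqP h.
    by rewrite exprMn h exprVn mulNr divff // expf_neq0.
  have := expf_card (b / a)%R; rewrite card_Fp //.
  (* As q = 2(2k + 1) + 1, an element z with z^2 = -1 has z^q = -z, while Fermat gives z^q = z. *)
  have hq : q = (q %/ 4).*2.+1.*2.+1.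
    by rewrite {1}(divn_eq q 4) q_mod4 -!muln2; lia.
  rewrite [X in (_ ^+ X)%R]hq exprS -mul2n exprM ba exprS -mul2n exprM sqrrN expr1n expr1n mulr1 => e.
  have ba0 : (b / a != 0)%R.
    by apply/eqP => z; move: ba; rewrite z expr0n /= => /eqP; rewrite eq_sym oppr_eq0 oner_eq0.
  move: two_neq0_Fp; rewrite -(inj_eq (mulfI ba0)) mulr0 => /eqP; apply.
  by rewrite mulr_natr mulr2n -{1}e mulrN1 addNr.
move=> h; apply: col2_eq; rewrite mxE; apply: sq; first exact: h.
by rewrite addrC; exact: h.
Qed.

Lemma card_T2_ge E : (q ^ 5 <= #|E| ^ 3 -> q ^ 3 <= 16 * #|T2 E|)%N.
Proof.
move=> hE; have q0 := prime_gt0 q_prime.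
have n0 : (0 < #|E|)%N.
  by rewrite lt0n; apply: contraTneq hE => ->; rewrite -ltnNge exp0n // expn_gt0 q0.
have := sum_overlap_cube two_neq0_Fp sqnorm_eq0_Fp (E := E).
rewrite card_Fp // => /(_ (prime_gt1 q_prime) hE) h1.
have h2 := card_sqr_le_fibers (@cong_class q) (triangles E).
rewrite card_triangles -expnM in h2.
rewrite -(leq_pmul2l (m := #|E| ^ 6)) ?expn_gt0 ?n0 //.
apply: leq_trans (leq_mul h2 (leqnn _)) _.
apply: leq_trans (leq_mul (leq_mul (leqnn _) (sum_class_le E)) (leqnn _)) _.
rewrite -mulnA; apply: leq_trans (leq_mul (leqnn _) h1) _.
rewrite -/(T2 E) leq_eqVlt; apply/orP; left; apply/eqP; ring.
Qed.

End Triangles.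

(* Transfer to real exponents and the final constant *)
From Stdlib Require Import Reals Lra.

Lemma INR_expn (m k : nat) : INR (expn m k) = (INR m ^ k)%R.
Proof. by elim: k => [//|k IH]; rewrite expnS -multE mult_INR IH. Qed.

(** Since [C >= 1], n is at least q^(7/4), and its cube is at least q^(21/4), which exceeds q^5 or
    equals it. *)
Lemma cube_ge_of_Rpower (C : R) (q n : nat) : (C > Rpower 2 (1 / 4))%R -> leq 1 q ->
  (INR n > C * Rpower (INR q) (7 / 4))%R -> leq (expn q 5) (expn n 3).
Proof.
move=> hC q0 hn.
have q1 : (1 <= INR q)%R by apply: (le_INR 1); apply/leP.
have C1 : (1 <= C)%R.
  have : (Rpower 2 0 <= Rpower 2 (1 / 4))%R by apply: Rle_Rpower; Lra.lra.
  rewrite Rpower_O; Lra.lra.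
have p0 : (0 < Rpower (INR q) (7 / 4))%R by apply: exp_pos.
have hn' : (Rpower (INR q) (7 / 4) <= INR n)%R by Lra.nra.
apply/leP/INR_le; rewrite !INR_expn.
apply: Rle_trans (pow_incr _ _ 3 (conj (Rlt_le _ _ p0) hn')).
rewrite -!Rpower_pow; try Lra.lra.
rewrite Rpower_mult; apply: Rle_Rpower => //=; Lra.lra.
Qed.

Theorem theorem1p1 :
  forall C1 : R, (C1 > Rpower 2 (1/4))%R ->
  exists C2 : R, (C2 > 0)%R /\
    forall (q : nat), prime q -> q %% 4 = 3 ->
    forall E : {set pt q},
      (INR #|E| > C1 * Rpower (INR q) (7/4))%R ->
      (INR #|T2 E| >= C2 * INR q ^ 3)%R.
Proof.
(* The constant 16 of [card_T2_ge] gives one value that serves for every [C1]. *)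
move=> C1 hC1; exists (1 / 16)%R; split; first Lra.lra.
move=> q hq q4 E hE.
have h5 := cube_ge_of_Rpower hC1 (prime_gt0 hq) hE.
have /leP/le_INR := card_T2_ge hq q4 h5.
rewrite -multE mult_INR INR_expn /=; Lra.lra.
Qed.
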